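(* There exist a complex Hilbert space and a densely defined closed operator $T$ on it such that $TT^*-T^*T$ is unbounded, but $|T||T^*|-|T^*||T|$ is bounded, and is even the zero operator on some domain (that is, there is a linear subspace $E$ such that $|T||T^*|-|T^*||T|$ is the zero operator with domain $E$).
   Context: Operators are linear maps $T$ defined on a linear subspace $D(T)$ of a Hilbert space $\mathcal H$ with values in $\mathcal H$; $T$ is closed if its graph is closed in $\mathcal H\oplus\mathcal H$. An operator $T$ is called bounded if there is a constant $M\ge 0$ with $\|Tx\|\le M\|x\|$ for all $x\in D(T)$ (boundedness is on its own domain, which need not be all of $\mathcal H$), and unbounded otherwise. $T^*$ denotes the adjoint of a densely defined operator $T$. Products and differences have their natural domains $D(RS)=\{x\in D(S): Sx\in D(R)\}$ and $D(R-S)=D(R)\cap D(S)$. For a densely defined closed operator $T$, $|T|=(T^*T)^{1/2}$ and $|T^*|=(TT^* )^{1/2}$ are the unique positive self-adjoint square roots of the positive self-adjoint operators $T^*T$ and $TT^*$. *)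

(* Defs.v *)
From HB Require Import structures.
From mathcomp Require Import all_boot all_order all_algebra complex.
From mathcomp Require Import all_classical all_reals all_analysis.

Set Implicit Arguments.
Unset Strict Implicit.
Unset Printing Implicit Defensive.

Import Order.TTheory GRing.Theory Num.Theory Num.Def.

Local Open Scope classical_set_scope.
Local Open Scope ring_scope.

(* The complex numbers are R[i]; the order of R[i] is partial, and 0 <= z means
   that z is a nonnegative real. The form is linear in its first argument. *)
Record hilbertType (R : realType) := HilbertType {
  hilbert_sort :> completeNormedModType R[i];
  inner : {dot hilbert_sort for conjC};
  innerE : forall x, inner x x = `|x| ^+ 2
}.

Section Operators.
Context {R : realType} {H : hilbertType R}.
Local Notation "''[' x , y ]" := (inner H x y).

Definition linear_subspace (E : set H) : Prop := submod_closed (mem E).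

(* The values of [op_fun] outside [dom] are irrelevant; hence operators are
   compared by [op_eq] and not by Leibniz equality. *)
Record operator := Operator {
  dom : set H;
  op_fun :> H -> H;
  dom_subspace : linear_subspace dom;
  op_linear : forall (a : R[i]) (x y : H), dom x -> dom y ->
    op_fun (a *: x + y) = a *: op_fun x + op_fun y
}.

Definition op_eq (S T : operator) : Prop :=
  dom S = dom T /\ {in dom S, S =1 T}.

Definition closed_op (T : operator) : Prop :=
  closed [set p : H * H | dom T p.1 /\ p.2 = T p.1].

Definition bounded_op (T : operator) : Prop :=
  exists2 M : R[i], 0 <= M & forall x, dom T x -> `|T x| <= M * `|x|.

Lemma subspace_lin (E : set H) (a : R[i]) (x y : H) :
  linear_subspace E -> E x -> E y -> E (a *: x + y).
Proof. by move=> [_ lE] Ex Ey; apply/set_mem/lE; apply/mem_set. Qed.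

Lemma subspace0 (E : set H) : linear_subspace E -> E 0.
Proof. by move=> [/set_mem]. Qed.

Lemma subspaceP (E : set H) : E 0 ->
  (forall (a : R[i]) x y, E x -> E y -> E (a *: x + y)) -> linear_subspace E.
Proof.
move=> E0 lE; split; first exact/mem_set.
by move=> a x y /set_mem Ex /set_mem Ey; apply/mem_set/lE.
Qed.

Lemma op0 (T : operator) : T 0 = 0.
Proof.
have T0 := subspace0 (dom_subspace T).
by have := op_linear (-1) T0 T0; rewrite scaler0 addr0 scaleN1r addNr.
Qed.

Section Zero.
Variables (E : set H) (hE : linear_subspace E).

Lemma zero_op_linear (a : R[i]) (x y : H) : E x -> E y ->
  (0 : H) = a *: (0 : H) + 0.
Proof. by rewrite scaler0 addr0. Qed.

Definition zero_op := @Operator E (fun=> 0) hE zero_op_linear.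

End Zero.

Section Sub.
Variables S T : operator.

Lemma sub_dom_subspace : linear_subspace (dom S `&` dom T).
Proof.
apply: subspaceP; first by split; apply: subspace0; apply: dom_subspace.
by move=> a x y [Sx Tx] [Sy Ty]; split; apply: subspace_lin => //;
  apply: dom_subspace.
Qed.

Lemma sub_op_linear (a : R[i]) (x y : H) :
  (dom S `&` dom T) x -> (dom S `&` dom T) y ->
  S (a *: x + y) - T (a *: x + y) = a *: (S x - T x) + (S y - T y).
Proof. by move=> [Sx Tx] [Sy Ty]; rewrite !op_linear// scalerBr opprD addrACA. Qed.

Definition sub_op :=
  @Operator (dom S `&` dom T) (fun x => S x - T x) sub_dom_subspace sub_op_linear.

End Sub.

Section Comp.
Variables S T : operator.

Lemma comp_dom_subspace : linear_subspace [set x | dom T x /\ dom S (T x)].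
Proof.
apply: subspaceP => /=.
  by rewrite op0; split; apply: subspace0; apply: dom_subspace.
by move=> a x y [Tx STx] [Ty STy]; rewrite op_linear//; split;
  apply: subspace_lin => //; apply: dom_subspace.
Qed.

Lemma comp_op_linear (a : R[i]) (x y : H) :
  dom T x /\ dom S (T x) -> dom T y /\ dom S (T y) ->
  S (T (a *: x + y)) = a *: S (T x) + S (T y).
Proof. by move=> [Tx STx] [Ty STy]; rewrite !op_linear. Qed.

Definition comp_op := @Operator [set x | dom T x /\ dom S (T x)]
  (fun x => S (T x)) comp_dom_subspace comp_op_linear.

End Comp.

Section Adjoint.
Variables (T : operator) (dT : dense (dom T)).

Definition adj_rel (y z : H) : Prop := forall x, dom T x -> '[T x, y] = '[x, z].

Lemma adj_rel_lin (a : R[i]) (y1 y2 z1 z2 : H) :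
  adj_rel y1 z1 -> adj_rel y2 z2 -> adj_rel (a *: y1 + y2) (a *: z1 + z2).
Proof.
by move=> h1 h2 x Tx; rewrite !linearPr /= h1// h2.
Qed.

Lemma adj_rel_uniq (y z1 z2 : H) : adj_rel y z1 -> adj_rel y z2 -> z1 = z2.
Proof.
move=> h1 h2; apply/eqP; rewrite -subr_eq0; apply/negP => /negP w0.
have : forall x, dom T x -> '[x, z1 - z2] = 0.
  by move=> x Tx; rewrite linearBr /= -h1// -h2// subrr.
move: (z1 - z2) w0 => w w0 ow.
have w_gt0 : 0 < `|w| by rewrite normr_gt0.
have w_ball : ball w `|w| !=set0 by exists w; apply: ballxx.
have [x [wx Tx]] := dT w_ball (ball_open w `|w|).
move: wx; rewrite -ball_normE /= -ltr_sqr ?nnegrE// -innerE.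
have xw : '[w, x] = 0 by rewrite hermC /= ow// rmorph0 mulr0.
rewrite linearBl /= !linearBr /= (ow x)// xw subr0 sub0r opprK !innerE => /lt_geF.
by rewrite lerDl exprn_ge0.
Qed.

(* Outside the domain of the adjoint, the value is the default 0. *)
Definition adj_fun (y : H) : H := xget 0 (adj_rel y).

Lemma adj_funP (y z : H) : adj_rel y z -> adj_rel y (adj_fun y).
Proof. by move=> yz; apply: xgetI yz. Qed.

Lemma adj_dom_subspace : linear_subspace [set y | exists z, adj_rel y z].
Proof.
apply: subspaceP => /=; first by exists 0 => x _; rewrite !linear0r.
by move=> a y1 y2 [z1 h1] [z2 h2]; exists (a *: z1 + z2); apply: adj_rel_lin.
Qed.

Lemma adj_linear (a : R[i]) (y1 y2 : H) :
  (exists z, adj_rel y1 z) -> (exists z, adj_rel y2 z) ->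
  adj_fun (a *: y1 + y2) = a *: adj_fun y1 + adj_fun y2.
Proof.
move=> [z1 /adj_funP h1] [z2 /adj_funP h2].
have h := adj_rel_lin a h1 h2.
exact: adj_rel_uniq (adj_funP h) h.
Qed.

Definition adjoint := @Operator [set y | exists z, adj_rel y z] adj_fun
  adj_dom_subspace adj_linear.

End Adjoint.

Definition selfadjoint (A : operator) : Prop :=
  exists dA : dense (dom A), op_eq (adjoint dA) A.

Definition positive_op (A : operator) : Prop :=
  forall x, dom A x -> 0 <= '[A x, x].

(* A is the positive self-adjoint square root of S, determined up to op_eq. *)
Definition is_sqrt_op (S A : operator) : Prop :=
  [/\ selfadjoint A, positive_op A & op_eq (comp_op A A) S].

End Operators.

Arguments operator {R} H.

(* Main.v *)
From HB Require Import structures.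
Require Import Defs.
From mathcomp Require Import all_boot all_order all_algebra complex.
From mathcomp Require Import all_classical all_reals all_analysis.
From mathcomp Require Import zify ring lra.

Set Implicit Arguments.
Unset Strict Implicit.
Unset Printing Implicit Defensive.

Import Order.TTheory GRing.Theory Num.Theory Num.Def.
Import numFieldNormedType.Exports.

(** Take for T a weighted permutation of the standard basis of l2: with s the
    involution of nat that exchanges 2n and 2n+1, and with w k = k,
      (T x)_k = w_k * x_(s k)
    on its maximal domain. Write T' for the adjoint of T. For an involution s it
    is an operator of the same form, with weights conj (w_(s k))
    ([adjoint_wcomp]); so T' T and T T' are the multiplications by |w_(s k)|^2
    and |w_k|^2, and their positive square roots |T| and |T'| are the
    multiplications by |w_(s k)| and |w_k| ([sqrt_adj_wcomp], for T and for T').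
    Two multiplication operators commute wherever both products are defined, so
    |T||T'| - |T'||T| is zero on its natural domain ([mult_commutator0]). On the
    other hand the basis vector of index 2n is an eigenvector of T T' - T' T for
    (2n)^2 - (2n+1)^2 = - (4n+1), and these eigenvalues are unbounded.

    With an involution, rather than a shift, the weighted permutations along s
    form a family closed under adjunction. Here s moreover preserves arbitrarily
    long initial segments of nat, so that a series and its rearrangement along s
    share a subsequence of partial sums, hence their limit ([is_csum_perm]).

    The space l2 over the complex numbers is built first. Its inner product is a
    convergent complex series, taken through the real and imaginary parts; the
    norm comes from the inner product by the Cauchy-Schwarz inequality;
    completeness is obtained from coordinatewise limits ([ell2_complete]). *)

(** * Square-summable sequences and complex series *)

Section SquareSummable.
Local Open Scope classical_set_scope.
Local Open Scope ring_scope.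
Local Notation "x %:C" := (real_complex _ x) : ring_scope.
Variable R : realType.
Local Notation Re := complex.Re.
Local Notation Im := complex.Im.
Implicit Types (z : R[i]) (f g : nat -> R[i]).

(** The squared modulus as an element of R rather than of R[i], so that partial
    sums are compared in a total order. *)
Definition sqn z : R := Re z ^+ 2 + Im z ^+ 2.

Lemma sqn_ge0 z : 0 <= sqn z.
Proof. by rewrite addr_ge0 ?sqr_ge0. Qed.

Lemma sqnE z : (sqn z)%:C = `|z| ^+ 2.
Proof. exact: add_Re2_Im2. Qed.

Lemma sqn0 : sqn 0 = 0.
Proof. by rewrite /sqn /= expr0n /= addr0. Qed.

Lemma sqnM z1 z2 : sqn (z1 * z2) = sqn z1 * sqn z2.
Proof. by apply: complexI; rewrite rmorphM /= !sqnE normrM exprMn. Qed.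

(** These fix the conjugation of the closed field structure: rewriting with the
    generic rmorphD and rmorphM would produce conjc. *)
Lemma conjD z1 z2 : (z1 + z2)^* = z1^* + z2^*.
Proof. exact: rmorphD. Qed.

Lemma conjM z1 z2 : (z1 * z2)^* = z1^* * z2^*.
Proof. exact: rmorphM. Qed.

Lemma sqn_norm z : sqn `|z| = sqn z.
Proof. by apply: complexI; rewrite !sqnE normr_id. Qed.

Lemma ReD z1 z2 : Re (z1 + z2) = Re z1 + Re z2.
Proof. by case: z1 z2 => ? ? []. Qed.

Lemma ImD z1 z2 : Im (z1 + z2) = Im z1 + Im z2.
Proof. by case: z1 z2 => ? ? []. Qed.

Lemma ReN z : Re (- z) = - Re z.
Proof. by case: z. Qed.

Lemma ImN z : Im (- z) = - Im z.
Proof. by case: z. Qed.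

Lemma ReM z1 z2 : Re (z1 * z2) = Re z1 * Re z2 - Im z1 * Im z2.
Proof. by case: z1 z2 => ? ? []. Qed.

Lemma ImM z1 z2 : Im (z1 * z2) = Re z1 * Im z2 + Im z1 * Re z2.
Proof. by case: z1 z2 => ? ? []. Qed.

Lemma ReJ z : Re z^* = Re z.
Proof. by case: z. Qed.

Lemma ImJ z : Im z^* = - Im z.
Proof. by case: z. Qed.

Lemma Re_sum n (F : 'I_n -> R[i]) :
  Re (\sum_(k < n) F k) = \sum_(k < n) Re (F k).
Proof. exact: (big_morph _ ReD). Qed.

Lemma Im_sum n (F : 'I_n -> R[i]) :
  Im (\sum_(k < n) F k) = \sum_(k < n) Im (F k).
Proof. exact: (big_morph _ ImD). Qed.

(** The difference of the two sides is sqn (z1 - z2). *)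
Lemma sqnD_le z1 z2 : sqn (z1 + z2) <= 2 * sqn z1 + 2 * sqn z2.
Proof.
rewrite /sqn ReD ImD -subr_ge0.
rewrite (_ : _ - _ = (Re z1 - Re z2) ^+ 2 + (Im z1 - Im z2) ^+ 2); last by ring.
by rewrite addr_ge0 ?sqr_ge0.
Qed.

(** Bounded partial sums, which for nonnegative terms is convergence. *)
Definition sqsum f := exists M : R, forall n, \sum_(k < n) sqn (f k) <= M.

Lemma sqsum_lin a f g : sqsum f -> sqsum g -> sqsum (fun k => a * f k + g k).
Proof.
move=> [M fM] [N gN]; exists (2 * sqn a * M + 2 * N) => n.
apply: (@le_trans _ _ (\sum_(k < n) (2 * sqn a * sqn (f k) + 2 * sqn (g k)))).
  by apply: ler_sum => k _; rewrite (le_trans (sqnD_le _ _))// sqnM mulrA.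
rewrite big_split /= -!mulr_sumr lerD ?ler_wpM2l ?fM ?gN//.
by rewrite mulr_ge0 ?sqn_ge0.
Qed.

Lemma le_psum (u : nat -> R) m n : (forall k, 0 <= u k) -> (m <= n)%N ->
  \sum_(k < m) u k <= \sum_(k < n) u k.
Proof.
move=> u0 mn; rewrite -!(big_mkord xpredT u) (big_cat_nat _ mn)//= lerDl.
by rewrite sumr_ge0.
Qed.

Lemma psum_fin (V : zmodType) (u : nat -> V) m n :
  (forall k, (m <= k)%N -> u k = 0) -> (m <= n)%N ->
  \sum_(k < n) u k = \sum_(k < m) u k.
Proof.
move=> u0 mn; rewrite -!(big_mkord xpredT u) (big_cat_nat _ mn)//=.
rewrite [X in _ + X]big_nat_cond [X in _ + X]big1 ?addr0//.
by move=> k /andP[/andP[mk _] _]; rewrite u0.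
Qed.

Lemma sqsum_fin f n : (forall k, (n <= k)%N -> f k = 0) -> sqsum f.
Proof.
move=> f0; exists (\sum_(k < n) sqn (f k)) => m.
have mono := @le_psum (sqn \o f) _ _ (fun k => sqn_ge0 (f k)).
apply: le_trans (mono _ _ (leq_maxl m n)) _.
rewrite (@psum_fin _ (sqn \o f) n) ?leq_maxr// => k nk.
by rewrite /= f0// sqn0.
Qed.

Definition is_csum f (s : R[i]) :=
  Re (\sum_(k < n) f k) @[n --> \oo] --> Re s /\
  Im (\sum_(k < n) f k) @[n --> \oo] --> Im s.

(** Meaningful only when the series converges; [is_csum] carries that. *)
Definition csum f : R[i] :=
  Complex (limn (fun n => \sum_(k < n) Re (f k)))
          (limn (fun n => \sum_(k < n) Im (f k))).

Lemma is_csum_eq f s : is_csum f s -> csum f = s.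
Proof.
move=> [h1 h2]; case: s h1 h2 => a b /= h1 h2.
rewrite /csum; under eq_fun do rewrite -Re_sum.
under [in X in Complex _ X]eq_fun do rewrite -Im_sum.
by congr Complex; apply: cvg_lim.
Qed.

Lemma is_csum_lin a f g s t : is_csum f s -> is_csum g t ->
  is_csum (fun k => a * f k + g k) (a * s + t).
Proof.
move=> [f1 f2] [g1 g2]; split.
  rewrite ReD ReM; under eq_fun do rewrite big_split /= -mulr_sumr ReD ReM.
  by apply: cvgD => //; apply: cvgB; apply: cvgM => //; apply: cvg_cst.
rewrite ImD ImM; under eq_fun do rewrite big_split /= -mulr_sumr ImD ImM.
by apply: cvgD => //; apply: cvgD; apply: cvgM => //; apply: cvg_cst.
Qed.

Lemma is_csumJ f s : is_csum f s -> is_csum (fun k => (f k)^*) s^*.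
Proof.
move=> [f1 f2]; split.
  by rewrite ReJ; under eq_fun do rewrite -rmorph_sum /= ReJ.
by rewrite ImJ; under eq_fun do rewrite -rmorph_sum /= ImJ; apply: cvgN.
Qed.

Lemma is_csum_fin f n : (forall k, (n <= k)%N -> f k = 0) ->
  is_csum f (\sum_(k < n) f k).
Proof.
move=> f0.
by split; apply: cvg_near_cst; exists n => // m /= nm; rewrite (psum_fin f0).
Qed.

(** In the order of R[i] this also says that s is real: every partial sum has
    imaginary part zero. *)
Lemma is_csum_ge0 f s : is_csum f s -> (forall k, 0 <= f k) -> 0 <= s.
Proof.
move=> [f1 f2] f0; have S n : 0 <= \sum_(k < n) f k by rewrite sumr_ge0.
rewrite lecE; apply/andP; split.
  apply/eqP; apply: (cvg_unique (@norm_hausdorff _ _) f2).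
  by apply: cvg_near_cst; apply: nearW => n; apply: ger0_Im.
apply: (cvgr_to_ge f1); apply: nearW => n.
by have := S n; rewrite lecE => /andP[].
Qed.

Lemma is_csum_sqn f (M : R) : is_csum (fun k => (sqn (f k))%:C) M%:C ->
  forall n, \sum_(k < n) sqn (f k) <= M.
Proof.
move=> [h _] n.
have E m : Re (\sum_(k < m) (sqn (f k))%:C) = \sum_(k < m) sqn (f k).
  by rewrite Re_sum.
apply: (cvgr_to_ge h); exists n => // m /= nm; rewrite E.
exact: (@le_psum (sqn \o f) _ _ (fun k => sqn_ge0 (f k)) nm).
Qed.

Lemma is_csum_le f (s M : R) : is_csum (fun k => (sqn (f k))%:C) s%:C ->
  (forall n, \sum_(k < n) sqn (f k) <= M) -> s <= M.
Proof.
move=> [h _] fM; apply: (cvgr_to_le h); apply: nearW => m.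
by rewrite Re_sum.
Qed.

Lemma abs_Re_mulJ z1 z2 : `|Re (z1 * z2^*)| <= sqn z1 + sqn z2.
Proof.
rewrite /sqn ReM ReJ ImJ; move: (Re z1) (Im z1) (Re z2) (Im z2) => a b c d.
have := sqr_ge0 (a - c); have := sqr_ge0 (b - d).
have := sqr_ge0 (a + c); have := sqr_ge0 (b + d).
by rewrite ler_norml !expr2 => *; apply/andP; split; nra.
Qed.

Lemma abs_Im_mulJ z1 z2 : `|Im (z1 * z2^*)| <= sqn z1 + sqn z2.
Proof.
rewrite /sqn ImM ReJ ImJ; move: (Re z1) (Im z1) (Re z2) (Im z2) => a b c d.
have := sqr_ge0 (b - c); have := sqr_ge0 (a - d).
have := sqr_ge0 (b + c); have := sqr_ge0 (a + d).
by rewrite ler_norml !expr2 => *; apply/andP; split; nra.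
Qed.

Lemma cvg_dominated_sum (u v : nat -> R) : (forall k, `|u k| <= v k) ->
  (exists M, forall n, \sum_(k < n) v k <= M) ->
  cvgn (fun n => \sum_(k < n) u k).
Proof.
move=> uv [M vM].
rewrite (_ : (fun n => _) = series u); last by rewrite seriesEord.
have v0 k : 0 <= v k := le_trans (normr_ge0 _) (uv k).
apply: normed_cvg; apply: (series_le_cvg _ v0 uv) => //.
apply: nondecreasing_is_cvgn.
  by apply/nondecreasing_seqP => n; rewrite seriesSr lerDl.
by exists M => _ [n _ <-]; rewrite /series /= big_mkord.
Qed.

(** Both parts of f k * conj (g k) are dominated by |f k|^2 + |g k|^2, so the
    series of an inner product converges absolutely. *)
Lemma is_csum_mulJ f g : sqsum f -> sqsum g ->
  is_csum (fun k => f k * (g k)^*) (csum (fun k => f k * (g k)^*)).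
Proof.
move=> [M fM] [N gN].
pose v k := sqn (f k) + sqn (g k).
have B : exists K, forall n, \sum_(k < n) v k <= K.
  by exists (M + N) => n; rewrite big_split lerD.
split => /=.
  under eq_fun do rewrite Re_sum.
  have := @cvg_dominated_sum (fun k => Re (f k * (g k)^*)) v _ B.
  by apply => k; apply: abs_Re_mulJ.
under eq_fun do rewrite Im_sum.
have := @cvg_dominated_sum (fun k => Im (f k * (g k)^*)) v _ B.
by apply => k; apply: abs_Im_mulJ.
Qed.

End SquareSummable.

(** * The norm of a positive definite form *)

Section Dot.
Local Open Scope ring_scope.
Variables (C : numClosedFieldType) (U : lmodType C) (form : {dot U for conjC}).
Local Notation "''[' u , v ]" := (form u v).

(** Split u into its projection a *: v on v and the rest w, orthogonal to v;
    then '[u, u] >= |a|^2 '[v, v] by Pythagoras, and '[u, v] = a '[v, v]. *)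
Lemma dot_CauchySchwarz u v : `|'[u, v]| ^+ 2 <= '[u, u] * '[v, v].
Proof.
have [->|v0] := eqVneq v 0.
  by rewrite linear0r normr0 expr0n mulr_ge0 ?dnorm_ge0.
have dv : '[v, v] != 0 by rewrite dnorm_eq0.
pose a := '[u, v] / '[v, v]; pose w := u - a *: v.
have wv : '[w, v] = 0 by rewrite linearBl linearZl_LR /= divfK// subrr.
have -> : u = w + a *: v by rewrite subrK.
rewrite hnormDd; last by rewrite linearZr_LR /= wv mulr0.
rewrite linearDl linearZl_LR /= wv add0r dnormZ mulrDl normrM exprMn.
by rewrite (ger0_norm (dnorm_ge0 _ _)) expr2 mulrA lerDr mulr_ge0 ?dnorm_ge0.
Qed.

Lemma dot_triangle u v :
  sqrtC '[u + v, u + v] <= sqrtC '[u, u] + sqrtC '[v, v].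
Proof.
rewrite -ler_sqr ?nnegrE ?addr_ge0 ?sqrt_dnorm_ge0//.
rewrite sqrrD !sqrtCK addrAC dnormD lerD2l.
have uvJ : '[u, v] + '[u, v]^* = 'Re '[u, v] *+ 2.
  by rewrite ReE -mulr_natr divfK ?pnatr_eq0.
rewrite uvJ lerMn2r /=; apply: le_trans (leif_Re_Creal _) _.
rewrite -ler_sqr ?nnegrE ?mulr_ge0 ?sqrt_dnorm_ge0// exprMn !sqrtCK.
exact: dot_CauchySchwarz.
Qed.

End Dot.

(** * The Hilbert space l2 *)

Section EllTwo.
Local Open Scope classical_set_scope.
Local Open Scope ring_scope.
Local Notation "x %:C" := (real_complex _ x) : ring_scope.
Variable R : realType.

Definition sqsum_pred : {pred nat -> R[i]} := [pred f | `[< sqsum f >] ].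

Record ell2 := Ell2 {
  ell2_val :> nat -> R[i];
  ell2P : ell2_val \in sqsum_pred
}.

HB.instance Definition _ := [isSub for ell2_val].
HB.instance Definition _ := [Choice of ell2 by <:].

Lemma sqsum_submod : submod_closed sqsum_pred.
Proof.
split; first by apply/asboolP; apply: (@sqsum_fin _ _ 0).
by move=> a f g /asboolP ? /asboolP ?; apply/asboolP; apply: sqsum_lin.
Qed.

HB.instance Definition _ :=
  GRing.isSubmodClosed.Build _ _ sqsum_pred sqsum_submod.
HB.instance Definition _ := [SubChoice_isSubLmodule of ell2 by <:].

Lemma ell2_sqsum (x : ell2) : sqsum x.
Proof. by apply/asboolP/ell2P. Qed.

Definition ell2_of f (fP : sqsum f) : ell2 := Ell2 (asboolT fP).

Lemma ell2_ext (x y : ell2) : (forall k, x k = y k) -> x = y.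
Proof. by move=> xy; apply/val_inj/funext. Qed.

Lemma ell2_lin a (x y : ell2) k : (a *: x + y) k = a * x k + y k.
Proof. by []. Qed.

Definition ell2_dot (x y : ell2) : R[i] := csum (fun k => x k * (y k)^*).

Lemma is_csum_dot (x y : ell2) :
  is_csum (fun k => x k * (y k)^*) (ell2_dot x y).
Proof. by apply: is_csum_mulJ; apply: ell2_sqsum. Qed.

Lemma ell2_dotC x y : ell2_dot x y = (-1) ^+ false * (ell2_dot y x)^*.
Proof.
rewrite expr0 mul1r; apply: is_csum_eq; have := is_csumJ (is_csum_dot y x).
by under eq_fun do rewrite conjM conjCK mulrC.
Qed.

Lemma ell2_dot_linl y : GRing.linear_for *%R (ell2_dot^~ y).
Proof.
move=> a x1 x2; apply: is_csum_eq.
under eq_fun do rewrite ell2_lin mulrDl -mulrA.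
by apply: is_csum_lin; apply: is_csum_dot.
Qed.

Lemma ell2_dot_linr x : GRing.linear_for (conjC \; *%R) (ell2_dot x).
Proof.
move=> a y1 y2; rewrite ell2_dotC ell2_dot_linl expr0 mul1r.
by rewrite conjD conjM /= (ell2_dotC x y1) (ell2_dotC x y2) expr0 !mul1r.
Qed.

HB.instance Definition _ := bilinear_isBilinear.Build _ _ _ _ _ _ ell2_dot
  (ell2_dot_linl, ell2_dot_linr).
HB.instance Definition _ :=
  isHermitianSesquilinear.Build _ _ _ _ ell2_dot ell2_dotC.

Lemma is_csum_dnorm (x : ell2) :
  is_csum (fun k => (sqn (x k))%:C) (ell2_dot x x).
Proof. by under eq_fun do rewrite sqnE normCK; apply: is_csum_dot. Qed.

Lemma ell2_dot_ge0 (x : ell2) : 0 <= ell2_dot x x.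
Proof.
by apply: (is_csum_ge0 (is_csum_dnorm x)) => k; rewrite sqnE exprn_ge0.
Qed.

(** A bound on all partial sums is a bound on the squared norm; this turns norm
    inequalities into statements on finitely many coordinates at a time. *)
Lemma ell2_dotP (x : ell2) (M : R) :
  ell2_dot x x <= M%:C <-> forall n, \sum_(k < n) sqn (x k) <= M.
Proof.
have := is_csum_dnorm x; rewrite -[ell2_dot x x]RRe_real ?ger0_real ?ell2_dot_ge0//.
rewrite lecR => xx; split => [xM n|]; last exact: is_csum_le.
exact: le_trans (is_csum_sqn xx n) xM.
Qed.

Lemma sqn_coord (x : ell2) k : (sqn (x k))%:C <= ell2_dot x x.
Proof.
have dR : (complex.Re (ell2_dot x x))%:C = ell2_dot x x.
  by rewrite RRe_real ?ger0_real ?ell2_dot_ge0.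
have := (ell2_dotP x (complex.Re (ell2_dot x x))).1.
rewrite -[in X in _ -> X]dR lecR dR => /(_ (lexx _) k.+1).
rewrite big_ord_recr /=; apply: le_trans.
by rewrite lerDr sumr_ge0// => i _; rewrite sqn_ge0.
Qed.

Lemma ell2_dot_gt0 (x : ell2) : x != 0 -> 0 < ell2_dot x x.
Proof.
rewrite lt_def ell2_dot_ge0 andbT; apply: contra => /eqP xx0.
apply/eqP/ell2_ext => k; have := sqn_coord x k.
rewrite xx0 sqnE => xk; apply/eqP; rewrite -normr_eq0 -sqrf_eq0.
by rewrite eq_le xk exprn_ge0.
Qed.

HB.instance Definition _ := isDotProduct.Build _ _ ell2_dot ell2_dot_gt0.

Definition ell2_norm (x : ell2) : R[i] := sqrtC (ell2_dot x x).

Lemma ell2_norm_triangle x y : ell2_norm (x + y) <= ell2_norm x + ell2_norm y.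
Proof. exact: dot_triangle. Qed.

Lemma ell2_normZ a x : ell2_norm (a *: x) = `|a| * ell2_norm x.
Proof.
rewrite /ell2_norm dnormZ sqrtCM ?nnegrE ?exprn_ge0 ?ell2_dot_ge0//.
by rewrite sqrCK.
Qed.

Lemma ell2_norm0_eq0 x : ell2_norm x = 0 -> x = 0.
Proof. by move=> /eqP; rewrite sqrtC_eq0 dnorm_eq0 => /eqP. Qed.

HB.instance Definition _ := Lmodule_isNormed.Build R[i] ell2
  ell2_norm_triangle ell2_normZ ell2_norm0_eq0.

Lemma ell2_normE (x : ell2) : ell2_dot x x = `|x| ^+ 2.
Proof. by rewrite sqrtCK. Qed.

Lemma ell2_norm_leP (x : ell2) (M : R) : 0 <= M ->
  `|x| <= M%:C <-> forall n, \sum_(k < n) sqn (x k) <= M ^+ 2.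
Proof.
move=> M0; rewrite -ell2_dotP ell2_normE rmorphXn /=.
by rewrite ler_sqr ?nnegrE// ler0c.
Qed.

Lemma norm_coord (x : ell2) k : `|x k| <= `|x|.
Proof. by rewrite -ler_sqr ?nnegrE// -sqnE -ell2_normE sqn_coord. Qed.

Lemma normc_ge_Im (z : R[i]) : `|complex.Im z|%:C <= `|z|.
Proof.
rewrite -normrN -ReiNIm (le_trans (normc_ge_Re _))// normrM.
by rewrite (_ : `|'i%C| = 1) ?mulr1// complexiE normCi.
Qed.

(** A Cauchy filter F converges in each coordinate, to a k say. If the ball of
    centre y and radius e is in F, then each finite sum of |y k - x k|^2 is at
    most e^2 for x near F; passing to the limit in x bounds the finite sums of
    |y k - a k|^2, so a is square-summable and at distance at most e from y. *)
Lemma ell2_complete (F : set_system ell2) : ProperFilter F -> cauchy F -> cvg F.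
Proof.
move=> FF /cauchyP Fc.
have Fc' (e : R) : 0 < e -> exists y, F (ball y e%:C).
  by move=> e0; apply: Fc; rewrite ltcR.
have cvg_coord (phi : R[i] -> R) k : (forall z t, phi (z - t) = phi z - phi t) ->
    (forall z, `|phi z|%:C <= `|z|) -> cvg (phi ((x : ell2) k) @[x --> F]).
  move=> phiB phi_le; apply/cauchy_cvgP/cauchyP => e /Fc'[y Fy].
  exists (phi (y k)); apply: (@filterS _ F _ (ball y e%:C)) Fy => z.
  rewrite -!ball_normE /= -ltcR; apply: le_lt_trans.
  apply: le_trans (norm_coord (y - z) k); apply: le_trans (phi_le _).
  by rewrite phiB.
have ReF k : cvg (complex.Re ((x : ell2) k) @[x --> F]).
  by apply: cvg_coord => [z t|z]; [rewrite ReD ReN|exact: normc_ge_Re].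
have ImF k : cvg (complex.Im ((x : ell2) k) @[x --> F]).
  by apply: cvg_coord => [z t|z]; [rewrite ImD ImN|exact: normc_ge_Im].
pose a k := Complex (lim (complex.Re ((x : ell2) k) @[x --> F]))
                    (lim (complex.Im ((x : ell2) k) @[x --> F])).
have near_a (e : R) y : 0 <= e -> F (ball y e%:C) ->
    forall n, \sum_(k < n) sqn (y k - a k) <= e ^+ 2.
  move=> e0 Fy n.
  have L : (\sum_(k < n) sqn (y k - (x : ell2) k)) @[x --> F] -->
      \sum_(k < n) sqn (y k - a k).
    apply: cvg_big => [|k _]; first exact: add_continuous.
    rewrite /sqn !(ReD, ImD, ReN, ImN).
    under eq_fun do rewrite !(ReD, ImD, ReN, ImN).
    have reC : (complex.Re (y k) - complex.Re ((x : ell2) k)) @[x --> F] -->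
      complex.Re (y k) - complex.Re (a k) by apply: cvgB; [exact: cvg_cst|exact: ReF].
    have imC : (complex.Im (y k) - complex.Im ((x : ell2) k)) @[x --> F] -->
      complex.Im (y k) - complex.Im (a k) by apply: cvgB; [exact: cvg_cst|exact: ImF].
    by apply: cvgD; apply: cvgM.
  apply: (cvgr_to_le L); apply: filterS Fy => z; rewrite -ball_normE /= => /ltW.
  by move=> /(ell2_norm_leP _ e0); exact.
have a_sq : sqsum a.
  have [y /(near_a _ _ ler01) ya] := Fc' 1 ltr01.
  (* a = - (y - a) + y is a combination of two square-summable sequences. *)
  rewrite (_ : a = fun k => (-1) * (y k - a k) + y k); last first.
    by apply/funext => k; ring.
  apply: sqsum_lin; last exact: ell2_sqsum.
  by exists (1 ^+ 2).
apply/cvg_ex; exists (ell2_of a_sq); apply/cvgrPdist_le => e e0.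
have e2 : 0 < complex.Re e / 2.
  by rewrite divr_gt0//; move: e0; rewrite ltcE => /andP[].
have [y Fy] := Fc' _ e2; apply: filterS (Fy) => x; rewrite -ball_normE /= => /ltW yx.
have ay : `|y - ell2_of a_sq| <= (complex.Re e / 2)%:C.
  by apply/(ell2_norm_leP _ (ltW e2)) => n; apply: near_a => //; exact: ltW.
rewrite -(subrKA y) -[e]RRe_real ?gtr0_real// [complex.Re e]splitr rmorphD.
by rewrite (le_trans (ler_normD _ _))// lerD// distrC.
Qed.

HB.instance Definition _ := Uniform_isComplete.Build ell2 ell2_complete.

Lemma ell2_innerE (x : ell2) : (ell2_dot : {dot ell2 for conjC}) x x = `|x| ^+ 2.
Proof. exact: ell2_normE. Qed.

Definition ell2_hilbert : hilbertType R := HilbertType ell2_innerE.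

End EllTwo.

(** * Rearranging series along an involution *)

Section BlockInvolution.
Local Open Scope classical_set_scope.
Local Open Scope ring_scope.

(** Over an invariant segment {0, ..., N - 1}, a sum is unchanged by the
    rearrangement; arbitrarily long ones are enough to compare limits. *)
Definition block_involution (s : nat -> nat) :=
  involutive s /\ forall n, exists2 N, (n <= N)%N & forall k, (s k < N)%N = (k < N)%N.

Lemma block_involution_id : block_involution id.
Proof. by split=> // n; exists n. Qed.

Definition swap (k : nat) : nat := if odd k then k.-1 else k.+1.

Lemma swapK : involutive swap.
Proof.
move=> k; rewrite /swap.
case: (boolP (odd k)) => [|/negPf kE] /=; last by rewrite kE.
by case: k => //= k /negPf ->.
Qed.

Lemma block_involution_swap : block_involution swap.
Proof.
split=> [|n]; first exact: swapK.
exists n.*2; first by rewrite -addnn leq_addr.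
move=> k; rewrite /swap; case: (boolP (odd k)) => kO.
  by move: kO (odd_double n); case: k => //= k; lia.
have := odd_double_half k; rewrite (negPf kO) add0n => kk.
by rewrite -kk -doubleS !ltn_double ltn_Sdouble; lia.
Qed.

Lemma block_sum (V : zmodType) s N (F : nat -> V) : involutive s ->
  (forall k, (s k < N)%N = (k < N)%N) -> \sum_(k < N) F (s k) = \sum_(k < N) F k.
Proof.
move=> sK sN; rewrite -(big_mkord xpredT (F \o s)) -(big_mkord xpredT F).
rewrite -(big_map s xpredT F); apply: perm_big; apply: uniq_perm.
- by rewrite map_inj_uniq ?iota_uniq//; apply: inv_inj.
- exact: iota_uniq.
- move=> k; rewrite -{1}(sK k) mem_map; last exact: inv_inj.
  by rewrite !mem_index_iota /= sN.
Qed.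

Variable R : realType.

Lemma sqsum_perm s (f : nat -> R[i]) : block_involution s ->
  sqsum f -> sqsum (f \o s).
Proof.
move=> [sK sB] [M fM]; exists M => n; have [N nN sN] := sB n.
apply: le_trans (fM N); rewrite -(block_sum (@sqn R \o f) sK sN).
exact: (le_psum (fun k => sqn_ge0 (f (s k)))).
Qed.

(** At the lengths N given by the invariant segments, the partial sums of f and
    of f \o s are equal, and these lengths tend to infinity. Convergence of the
    rearranged series, here assumed, then identifies both limits. *)
Lemma is_csum_perm s (f : nat -> R[i]) a b : block_involution s ->
  is_csum f a -> is_csum (f \o s) b -> a = b.
Proof.
move=> [sK sB] [fr fi] [gr gi].
have /choice[N NP] : forall n, exists N,
    (n <= N)%N /\ forall k, (s k < N)%N = (k < N)%N.
  by move=> n; have [N] := sB n; exists N.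
have Noo : N n @[n --> \oo] --> \oo.
  by move=> P [m _ mP]; exists m => // n /= mn; apply: mP => /=;
    apply: leq_trans mn (NP n).1.
have E n : \sum_(k < N n) (f \o s) k = \sum_(k < N n) f k.
  by apply: (block_sum f sK); have [] := NP n.
have U (phi : R[i] -> R) (x y : R) :
    phi (\sum_(k < n) f k) @[n --> \oo] --> x ->
    phi (\sum_(k < n) (f \o s) k) @[n --> \oo] --> y -> x = y.
  move=> /(cvg_comp _ _ Noo) fx /(cvg_comp _ _ Noo) gy.
  apply: (cvg_unique (@norm_hausdorff _ _) fx).
  by apply: cvg_trans gy; apply: near_eq_cvg; apply: nearW => n /=; rewrite -E.
apply/eqP; rewrite eq_complex; apply/andP; split; apply/eqP.
  exact: U fr gr.
exact: U fi gi.
Qed.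

End BlockInvolution.

(** * Weighted permutation operators on l2 *)

Section Operators.
Local Open Scope classical_set_scope.
Local Open Scope ring_scope.
Variable R : realType.
Local Notation H := (ell2_hilbert R).
Local Notation "x %:C" := (real_complex _ x) : ring_scope.
Local Notation "''[' x , y ]" := (inner H x y).
Implicit Types (x y z : H) (w : nat -> R[i]) (s : nat -> nat).

(** Kept folded, so that the vector space structure seen in coordinates stays
    the one of the Hilbert space and not the one of functions. *)
Definition coord (k : nat) (x : H) : R[i] := ell2_val x k.

Arguments coord : simpl never.

Lemma coord_lin k a x y : coord k (a *: x + y) = a * coord k x + coord k y.
Proof. by []. Qed.

Lemma coordB k x y : coord k (x - y) = coord k x - coord k y.
Proof. by []. Qed.

Lemma coord_ext x y : (forall k, coord k x = coord k y) -> x = y.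
Proof. exact: ell2_ext. Qed.

Lemma norm_coord_le k x : `|coord k x| <= `|x|.
Proof. exact: norm_coord. Qed.

Lemma sqsum_coord x : sqsum (coord^~ x).
Proof. exact: ell2_sqsum. Qed.

Lemma is_csum_inner x y : is_csum (fun k => coord k x * (coord k y)^*) '[x, y].
Proof. exact: is_csum_dot. Qed.

(** Zero when f is not square-summable. *)
Definition of_seq (f : nat -> R[i]) : H := insubd (0 : ell2 R) f.

Lemma of_seqE f k : sqsum f -> coord k (of_seq f) = f k.
Proof.
move=> fP; rewrite /coord /of_seq -[ell2_val _]/(val _) insubdK//.
exact/asboolP.
Qed.

Definition delta (j : nat) : H := of_seq (fun k => (k == j)%:R).

Lemma deltaE j k : coord k (delta j) = (k == j)%:R.
Proof.
rewrite of_seqE//; apply: (@sqsum_fin _ _ j.+1) => i ji.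
by rewrite gtn_eqF.
Qed.

Lemma inner_delta j y : '[delta j, y] = (coord j y)^*.
Proof.
rewrite -(is_csum_eq (is_csum_inner _ _)); apply: is_csum_eq.
have := @is_csum_fin _ (fun k => coord k (delta j) * (coord k y)^*) j.+1.
rewrite big_ord_recr /= big1 => [|i _]; last by rewrite deltaE ltn_eqF// mul0r.
rewrite deltaE eqxx add0r mul1r; apply => k jk.
by rewrite deltaE gtn_eqF// mul0r.
Qed.

Lemma norm_delta j : `|delta j| = 1.
Proof.
apply/eqP; rewrite -(@eqrXn2 _ 2)// -innerE inner_delta deltaE eqxx expr1n.
by rewrite conjC1.
Qed.

Definition finite_support : set H :=
  [set x | exists n, forall k, (n <= k)%N -> coord k x = 0].

(** The truncation t n of x is orthogonal to x - t n, so |x - t n|^2 is the tail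
    '[x, x] - \sum_(k < n) |x k|^2 of a convergent series. *)
Lemma dense_finite_support : dense finite_support.
Proof.
move=> O [x Ox] /(_ x Ox) /nbhs_ballP[e /= e0 eO].
pose t n : H := of_seq (fun k => if (k < n)%N then coord k x else 0).
have tE n k : coord k (t n) = if (k < n)%N then coord k x else 0.
  rewrite of_seqE//; apply: (@sqsum_fin _ _ n) => i ni.
  by rewrite ltnNge ni.
suff [n xt] : exists n, `|x - t n| < e.
  exists (t n); split; last by exists n => k nk; rewrite tE ltnNge nk.
  by apply: eO; rewrite -ball_normE.
have tt n : '[t n, t n] = (\sum_(k < n) sqn (coord k x))%:C.
  rewrite -(is_csum_eq (is_csum_inner _ _)); apply: is_csum_eq.
  have := @is_csum_fin _ (fun k => coord k (t n) * (coord k (t n))^*) n.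
  rewrite (_ : \sum_(k < n) _ = (\sum_(k < n) sqn (coord k x))%:C).
    by apply => k nk; rewrite tE ltnNge nk mul0r.
  rewrite rmorph_sum; apply: eq_bigr => k _.
  by rewrite /= tE ltn_ord -normCK sqnE.
have xtt n : '[x - t n, t n] = 0.
  rewrite -(is_csum_eq (is_csum_inner _ _)); apply: is_csum_eq.
  have := @is_csum_fin _ (fun k => coord k (x - t n) * (coord k (t n))^*) 0.
  rewrite big_ord0; apply => k _; rewrite coordB tE.
  by case: ifP; rewrite ?subrr ?mul0r// conjC0 mulr0.
have xt n : `|x - t n| ^+ 2 = `|x| ^+ 2 - (\sum_(k < n) sqn (coord k x))%:C.
  by rewrite -!innerE -tt -[in '[x, x]](subrK (t n) x) (hnormDd (xtt n)) addrK.
have [xx _] := is_csum_dnorm x.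
have /cvgrPdist_lt/(_ (complex.Re e ^+ 2)) := xx.
rewrite exprn_gt0 => [/(_ isT)[n _ /(_ n (leqnn n)) /= xn]|]; last first.
  by move: e0; rewrite ltcE => /andP[].
exists n; rewrite -ltr_sqr ?nnegrE ?(ltW e0)// xt -innerE.
have dR : (complex.Re '[x, x])%:C = '[x, x].
  by rewrite RRe_real// innerE ger0_real ?exprn_ge0.
rewrite -dR -[e]RRe_real ?gtr0_real// -rmorphB -rmorphXn ltcR /=.
by apply: le_lt_trans xn; rewrite Re_sum ler_norm.
Qed.

Definition wcomp_fun w s (x : H) : H := of_seq (fun k => w k * coord (s k) x).

Definition wcomp_dom w s : set H := [set x | sqsum (fun k => w k * coord (s k) x)].

Lemma wcomp_dom_subspace w s : linear_subspace (wcomp_dom w s).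
Proof.
apply: subspaceP => [|a x y dx dy]; rewrite /wcomp_dom /=.
  by apply: (@sqsum_fin _ _ 0) => k _; rewrite mulr0.
rewrite (_ : (fun k => _) = fun k => a * (w k * coord (s k) x) + w k * coord (s k) y).
  exact: sqsum_lin.
by apply/funext => k; rewrite coord_lin mulrDr mulrCA.
Qed.

Lemma wcomp_linear w s (a : R[i]) x y : wcomp_dom w s x -> wcomp_dom w s y ->
  wcomp_fun w s (a *: x + y) = a *: wcomp_fun w s x + wcomp_fun w s y.
Proof.
move=> dx dy; apply: coord_ext => k; rewrite coord_lin !of_seqE//.
  by rewrite coord_lin mulrDr mulrCA.
exact: (subspace_lin a (wcomp_dom_subspace w s) dx dy).
Qed.

(** The maximal operator (x k)_k |-> (w k * x (s k))_k; for s = id it is the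
    multiplication by w. *)
Definition wcomp w s : operator H :=
  Operator (wcomp_dom_subspace w s) (@wcomp_linear w s).

Lemma coord_wcomp w s x k : dom (wcomp w s) x ->
  coord k (wcomp w s x) = w k * coord (s k) x.
Proof. exact: (@of_seqE (fun k => w k * coord (s k) x)). Qed.

(** The image of a vector supported in [0, n) is supported in any segment
    preserved by s that contains [0, n). *)
Lemma wcomp_finite_support w s : block_involution s ->
  finite_support `<=` dom (wcomp w s).
Proof.
move=> [_ sB] x [n xn]; have [N nN sN] := sB n.
apply: (@sqsum_fin _ _ N) => k Nk; rewrite xn ?mulr0//.
by rewrite (leq_trans nN)// leqNgt sN -leqNgt.
Qed.

Lemma dense_wcomp w s : block_involution s -> dense (dom (wcomp w s)).
Proof.
move=> sB O O0 oO; have [x [Ox fx]] := dense_finite_support O0 oO.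
by exists x; split=> //; exact: (wcomp_finite_support w sB fx).
Qed.

Lemma delta_finite_support j : finite_support (delta j).
Proof. by exists j.+1 => k jk; rewrite deltaE gtn_eqF. Qed.

Lemma wcomp_delta w s j : block_involution s ->
  wcomp w s (delta j) = w (s j) *: delta (s j).
Proof.
move=> sB; apply: coord_ext => k; rewrite coord_wcomp; last first.
  exact: (wcomp_finite_support w sB (delta_finite_support _)).
rewrite -[_ *: _]addr0 coord_lin addr0 !deltaE.
have [<-|ne] := eqVneq (s k) j; first by rewrite sB.1 eqxx.
rewrite (_ : (k == s j) = false) ?mulr0//.
by apply: contra_neqF ne => /eqP ->; rewrite sB.1.
Qed.

Definition wadj w s : nat -> R[i] := fun k => (w (s k))^*.

Lemma wadjK w s : block_involution s -> wadj (wadj w s) s = w.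
Proof. by move=> [sK _]; apply/funext => k; rewrite /wadj sK conjCK. Qed.

(** Testing the adjoint relation on the basis vectors forces the coordinates of z,
    and the sequence so obtained is square-summable because z is a vector: this
    is why the adjoint is no larger than the maximal operator. Conversely the two
    inner products are series that differ by the rearrangement s. *)
Lemma adj_rel_wcomp w s y z : block_involution s ->
  adj_rel (wcomp w s) y z <->
  dom (wcomp (wadj w s) s) y /\ z = wcomp (wadj w s) s y.
Proof.
move=> sB; split => [yz|[dy ->] x dx].
  have zE k : coord k z = wadj w s k * coord (s k) y.
    have /yz : dom (wcomp w s) (delta k).
      exact: (wcomp_finite_support w sB (delta_finite_support _)).
    rewrite wcomp_delta// linearZl_LR /= !inner_delta => /(congr1 conjC).
    by rewrite conjM !conjCK /wadj => ->.
  have dy : dom (wcomp (wadj w s) s) y.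
    by rewrite /= /wcomp_dom /= -(funext zE); apply: sqsum_coord.
  by split=> //; apply: coord_ext => k; rewrite coord_wcomp.
have h1 := is_csum_inner (wcomp w s x) y.
have h2 := is_csum_inner x (wcomp (wadj w s) s y).
apply: (is_csum_perm sB h1); congr is_csum: h2.
apply/funext => k; rewrite /= !coord_wcomp// sB.1 /wadj conjM conjCK.
by rewrite mulrCA mulrA.
Qed.

Lemma adjoint_wcomp w s (sB : block_involution s) (dT : dense (dom (wcomp w s))) :
  op_eq (adjoint dT) (wcomp (wadj w s) s).
Proof.
split.
  apply/seteqP; split => y /=; first by case=> z /(adj_rel_wcomp _ _ _ sB)[].
  by move=> dy; exists (wcomp (wadj w s) s y); apply/adj_rel_wcomp.
by move=> y /set_mem [z /adj_funP /(adj_rel_wcomp _ _ _ sB)[_ yE]]; exact: yE.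
Qed.

(** The graph is cut out by the equations y k = w k * x (s k), each between
    continuous functions of (x, y): the condition on the domain follows from
    them, since y is square-summable. *)
Lemma closed_wcomp w s : closed_op (wcomp w s).
Proof.
move=> p pcl.
suff pE k : coord k p.2 = w k * coord (s k) p.1.
  have dp : dom (wcomp w s) p.1.
    by rewrite /= /wcomp_dom /= -(funext pE); apply: sqsum_coord.
  by split=> //; apply: coord_ext => k; rewrite coord_wcomp.
apply/eqP; rewrite -subr_eq0 -normr_le0; apply/ler_addgt0Pl => e e0.
(* d is chosen so that d + `|w k| * d = e. *)
rewrite addr0; pose d := e / (1 + `|w k|).
have w1 : 0 < 1 + `|w k| by rewrite ltr_pwDl.
have d0 : 0 < d by rewrite divr_gt0.
have [|q [[dq qE] [q1 q2]]] := pcl (ball p.1 d `*` ball p.2 d).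
  by exists (ball p.1 d, ball p.2 d) => //; split; apply: nbhsx_ballx.
have c2 := norm_coord_le k (p.2 - q.2); have c1 := norm_coord_le (s k) (p.1 - q.1).
move: q1 q2; rewrite -!ball_normE /= => /ltW q1 /ltW q2.
rewrite (_ : _ - _ = coord k (p.2 - q.2) - w k * coord (s k) (p.1 - q.1)).
  rewrite (le_trans (ler_normB _ _))// normrM (_ : e = d + `|w k| * d).
    by rewrite lerD ?ler_wpM2l ?(le_trans c1 q1) ?(le_trans c2 q2).
  by rewrite -{1}[d]mul1r -mulrDl mulrC divfK// gt_eqF.
by rewrite !coordB qE coord_wcomp// mulrBr opprB addrA subrK.
Qed.

Lemma selfadjoint_mult w : (forall k, 0 <= w k) -> selfadjoint (wcomp w id).
Proof.
move=> w0; have d := dense_wcomp w block_involution_id; exists d.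
have := adjoint_wcomp block_involution_id d.
rewrite (_ : wadj w id = w)//; apply/funext => k.
by rewrite /wadj conj_Creal// ger0_real.
Qed.

Lemma positive_mult w : (forall k, 0 <= w k) -> positive_op (wcomp w id).
Proof.
move=> w0 x dx; apply: is_csum_ge0 (is_csum_inner _ _) _ => k.
by rewrite coord_wcomp// -mulrA -normCK mulr_ge0// exprn_ge0.
Qed.

(** The two sequences have the same moduli up to the rearrangement s. *)
Lemma dom_wcomp_norm w s x : block_involution s ->
  dom (wcomp w s) x <-> dom (wcomp (fun k => `|w (s k)|) id) x.
Proof.
have E (f g : nat -> R[i]) : (forall k, sqn (f k) = sqn (g k)) -> sqsum f -> sqsum g.
  move=> fg [M fM]; exists M => n; rewrite (le_trans _ (fM n))// le_eqVlt.
  by apply/orP; left; apply/eqP; apply: eq_bigr => k _; rewrite fg.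
move=> sB; split => /(sqsum_perm sB); apply: E => k /=.
  by rewrite sB.1 !sqnM sqn_norm.
by rewrite sB.1 !sqnM sqn_norm.
Qed.

(** On the common domain given by [dom_wcomp_norm], both products have
    coordinates |w (s k)|^2 * x k, so that one is defined, as a vector of l2,
    exactly when the other is. *)
Lemma sqrt_adj_wcomp w s : block_involution s ->
  is_sqrt_op (comp_op (wcomp (wadj w s) s) (wcomp w s))
             (wcomp (fun k => `|w (s k)|) id).
Proof.
move=> sB; set m := fun k => `|w (s k)|.
have m0 k : 0 <= m k by rewrite normr_ge0.
split; [exact: selfadjoint_mult|exact: positive_mult|].
(* The values of |T| |T| and of T' T, as sequences. *)
have sqE x : dom (wcomp w s) x -> dom (wcomp m id) x ->
    (fun k => m k * coord k (wcomp m id x)) =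
    (fun k => wadj w s k * coord (s k) (wcomp w s x)).
  move=> dx dx'; apply/funext => k; rewrite !coord_wcomp// sB.1 !mulrA.
  by congr (_ * _); rewrite /m /wadj -expr2 normCK mulrC.
split.
  apply/seteqP; split => x /= [dx1 dx2].
    have dx := (dom_wcomp_norm w x sB).2 dx1; split=> //.
    by rewrite /wcomp_dom /= -(sqE _ dx dx1).
  have dx := (dom_wcomp_norm w x sB).1 dx1; split=> //.
  by rewrite /wcomp_dom /= (sqE _ dx1 dx).
move=> x /set_mem /= [dx1 dx2]; have dx := (dom_wcomp_norm w x sB).2 dx1.
by apply: coord_ext => k; rewrite /= /wcomp_fun (sqE _ dx dx1).
Qed.

Lemma mult_commutator0 w1 w2 :
  let C := sub_op (comp_op (wcomp w1 id) (wcomp w2 id))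
                  (comp_op (wcomp w2 id) (wcomp w1 id)) in
  op_eq C (zero_op (dom_subspace C)).
Proof.
split=> // x /set_mem[[dx2 dx12] [dx1 dx21]] /=.
apply/eqP; rewrite subr_eq0; apply/eqP/coord_ext => k.
by rewrite !coord_wcomp// mulrCA.
Qed.

(** The basis vectors are eigenvectors of such a product; coordinate j gives the
    eigenvalue, which is all that a lower bound on the norm requires. *)
Lemma comp_wcomp_delta w1 w2 s j : block_involution s ->
  let S := comp_op (wcomp w1 s) (wcomp w2 s) in
  dom S (delta j) /\ coord j (S (delta j)) = w1 j * w2 (s j).
Proof.
move=> sB.
have d2 : dom (wcomp w2 s) (delta j).
  exact: (wcomp_finite_support w2 sB (delta_finite_support _)).
have d1 : dom (wcomp w1 s) (wcomp w2 s (delta j)).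
  apply: (wcomp_finite_support w1 sB); exists (s j).+1 => k jk.
  rewrite wcomp_delta// -[_ *: _]addr0 coord_lin addr0 deltaE gtn_eqF//.
  by rewrite mulr0.
by split=> //; rewrite /= !coord_wcomp// sB.1 deltaE eqxx mulr1.
Qed.

End Operators.

(** * Equality of operators and products *)

Section OpEq.
Context {R : realType} {H : hilbertType R}.
Implicit Types S T : operator H.

Lemma op_eq_sym S T : op_eq S T -> op_eq T S.
Proof. by move=> [d e]; split=> // x; rewrite -d => /e. Qed.

Lemma op_eq_trans S T U : op_eq S T -> op_eq T U -> op_eq S U.
Proof.
by move=> [d1 e1] [d2 e2]; split=> [|x dx]; rewrite ?d1// e1// e2// -d1.
Qed.

Lemma comp_op_eq S S' T T' :
  op_eq S S' -> op_eq T T' -> op_eq (comp_op S T) (comp_op S' T').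
Proof.
move=> [dS eS] [dT eT]; split.
  apply/seteqP; split => x /= [dx1 dx2].
    by rewrite -dT -dS -(eT x (mem_set dx1)).
  by rewrite -dT in dx1; rewrite dS eT// inE.
by move=> x /set_mem /= [dx1 dx2]; rewrite -eT ?eS ?inE.
Qed.

Lemma is_sqrt_op_eq S S' T : op_eq S S' -> is_sqrt_op S T -> is_sqrt_op S' T.
Proof. by move=> SS' [sa pos e]; split=> //; apply: op_eq_trans e SS'. Qed.

End OpEq.

(** * The counterexample *)

Theorem proposition2p7 (R : realType) :
  exists (H : hilbertType R) (T : operator H) (dT : dense (dom T)),
    let Tstar := adjoint dT in
    [/\ closed_op T,
        ~ bounded_op (sub_op (comp_op T Tstar) (comp_op Tstar T))
      & exists absT absTstar : operator H,
          let C := sub_op (comp_op absT absTstar) (comp_op absTstar absT) in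
          [/\ is_sqrt_op (comp_op Tstar T) absT,
              is_sqrt_op (comp_op T Tstar) absTstar,
              bounded_op C
            & exists (E : set H) (hE : linear_subspace E), op_eq C (zero_op hE)]].
Proof.
pose s := swap; pose w k : R[i] := k%:R%R; pose w' := wadj w s.
have sB : block_involution s := block_involution_swap.
pose T := wcomp w s; pose T' := wcomp w' s.
have dT : dense (dom T) := dense_wcomp w sB.
exists (ell2_hilbert R), T, dT => Tstar.
have TstarE : op_eq T' Tstar by apply/op_eq_sym/adjoint_wcomp.
have refl (S : operator (ell2_hilbert R)) : op_eq S S by [].
have TsT := comp_op_eq TstarE (refl T).
have TTs := comp_op_eq (refl T) TstarE.
pose absT : operator (ell2_hilbert R) := wcomp (fun k => `|w (s k)|%R) id.
pose absT' : operator (ell2_hilbert R) := wcomp (fun k => `|w' (s k)|%R) id.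
have C0 := mult_commutator0 (fun k => `|w (s k)|%R) (fun k => `|w' (s k)|%R).
split; first exact: closed_wcomp.
- move=> [M M0 TM].
  (* The even basis vector of index j = 2n has eigenvalue j^2 - (j+1)^2, of
     modulus 4n + 1. *)
  have large n : (n%:R <= M)%R.
    pose j := n.*2; have sj : s j = j.+1 by rewrite /s /swap odd_double.
    have [dTT eTT] := comp_wcomp_delta w w' j sB.
    have [dTT' eTT'] := comp_wcomp_delta w' w j sB.
    have dTTs : dom (comp_op T Tstar) (delta R j) by rewrite -TTs.1.
    have dTsT : dom (comp_op Tstar T) (delta R j) by rewrite -TsT.1.
    have := TM (delta R j) (conj dTTs dTsT); rewrite norm_delta mulr1.
    apply: le_trans; apply: le_trans (norm_coord_le j _).
    have -> : sub_op (comp_op T Tstar) (comp_op Tstar T) (delta R j) =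
        (comp_op T T' (delta R j) - comp_op T' T (delta R j))%R.
      by rewrite (TTs.2 _ (mem_set dTT)) (TsT.2 _ (mem_set dTT')).
    rewrite coordB eTT eTT' /w' /wadj sB.1 sj.
    rewrite /w !conjC_nat -!natrM distrC -natrB ?leq_mul//.
    by rewrite normr_nat ler_nat /j -addnn; lia.
  have := large (Num.truncn (complex.Re M)).+1.
  rewrite -[M]RRe_real ?ger0_real// -(rmorph_nat (real_complex R)) lecR.
  by rewrite leNgt truncnS_gt.
- exists absT, absT' => C; split.
  + exact: is_sqrt_op_eq TsT (sqrt_adj_wcomp w sB).
  + apply: is_sqrt_op_eq TTs _; have := sqrt_adj_wcomp w' sB.
    by rewrite /w' wadjK.
  + by exists 0%R => // x dx; rewrite (C0.2 x (mem_set dx)) /= normr0 mul0r.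
  + by exists (dom C), (dom_subspace C).
Qed.
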